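(* For every integer $n\geq 8$ there exists an almost 2-perfect (A2P) maximum 8-cycle packing of $K_n$.
   Context: An 8-cycle packing of $K_n$ on an $n$-element vertex set $\mathcal{X}$ is a triple $(\mathcal{X},\mathcal{C},\mathcal{L})$ where $\mathcal{C}$ is a collection of pairwise edge-disjoint 8-cycles of $K_n$ and the leave $\mathcal{L}$ is the set of edges of $K_n$ lying in no cycle of $\mathcal{C}$. It is a maximum packing if $|\mathcal{L}|$ is as small as possible among all 8-cycle packings of $K_n$. For an 8-cycle $C$, an inside 8-cycle of $C$ is an 8-cycle on the same vertex set as $C$ sharing no edge with $C$. The packing $(\mathcal{X},\mathcal{C},\mathcal{L})$ is almost 2-perfect (A2P) if one can choose, for each $C\in\mathcal{C}$, an inside 8-cycle $C'$ of $C$ such that the chosen cycles $\mathcal{C}'=\{C'\}$ are pairwise edge-disjoint and contain no edge of $\mathcal{L}$, i.e. $(\mathcal{X},\mathcal{C}',\mathcal{L})$ is again an 8-cycle packing of $K_n$ with the same leave. *)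

(* Defs.v *)
From mathcomp Require Import all_boot.
Set Implicit Arguments. Unset Strict Implicit. Unset Printing Implicit Defensive.

Definition edge (n : nat) := {set 'I_n}.
Definition is_edge n (e : edge n) : bool := #|e| == 2.

Definition cyc8 (n : nat) := 8.-tuple 'I_n.
Definition is_cyc8 n (c : cyc8 n) : bool := uniq c.

Definition cverts n (c : cyc8 n) : {set 'I_n} := [set tnth c i | i : 'I_8].
Definition cedges n (c : cyc8 n) : {set edge n} :=
  [set [set tnth c i; tnth c (ordS i)] | i : 'I_8].

Definition is_packing n (C : seq (cyc8 n)) : bool :=
  all (@is_cyc8 n) C &&
  pairwise (fun c d => [disjoint cedges c & cedges d]) C.

Definition leave n (C : seq (cyc8 n)) : {set edge n} :=
  [set e : edge n | is_edge e & all (fun c => e \notin cedges c) C].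

Definition is_max_packing n (C : seq (cyc8 n)) : Prop :=
  is_packing C /\
  forall C' : seq (cyc8 n), is_packing C' -> #|leave C| <= #|leave C'|.

Definition inside n (c d : cyc8 n) : bool :=
  [&& is_cyc8 d, cverts d == cverts c & [disjoint cedges c & cedges d]].

Definition A2P n (C : seq (cyc8 n)) : Prop :=
  exists C' : seq (cyc8 n),
    all2 (@inside n) C C' /\ is_packing C' /\ leave C' = leave C.

(* Main.v *)
(** Up to isomorphism an 8-cycle has exactly one complement in [K_{4,4}], again an 8-cycle, so [K_{4,4}] consists of two cycles that are inside cycles of each other.  Together with a decomposition of [K_{6,4}] into three cycles this handles every [K_{2a,4b}] with [a <> 1].  Splitting the vertices as [n + 8] (n even), or as [n + 16] with the two parts sharing one vertex (n odd), reduces the problem to finitely many complete graphs, packed explicitly; for 15 and 23 vertices, 6 of them are split off by a packing of [K_11] minus [K_5].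

Only the number of cycles matters for maximality: the leave has as many edges as [n (n - 1) / 2] modulo 8, and all its degrees have the parity of [n - 1].  Hence it has at least [n / 2] edges if [n] is even, and neither one nor two edges if [n] is odd, and the packings constructed meet these bounds. *)
Require Import Defs.
From mathcomp Require Import all_boot.
From mathcomp Require Import zify.
Set Implicit Arguments. Unset Strict Implicit. Unset Printing Implicit Defensive.

(** * 8-cycles paired with inside cycles, over arbitrary vertex types *)

Definition cycle_arcs (T : eqType) (c : seq T) := zip c (rot 1 c).

Definition cycle_adj (T : eqType) (c : seq T) : rel T :=
  fun x y => ((x, y) \in cycle_arcs c) || ((y, x) \in cycle_arcs c).

(** [perm_eq] transfers length, distinctness and vertex set to the second sequence. *)
Definition inside_pair (T : eqType) (p : seq T * seq T) : bool :=
  [&& size p.1 == 8, uniq p.1, perm_eq p.1 p.2 &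
      all (fun e => ~~ cycle_adj p.2 e.1 e.2) (cycle_arcs p.1)].

(* A pair consists of a cycle and its inside cycle.  [G x y] is read as 0 or 1: every edge is used at most once, and only edges of [G] are used. *)
Definition packs (T : eqType) (P : seq (seq T * seq T)) (G : rel T) : Prop :=
  all (@inside_pair T) P /\
  forall x y,
    count (fun p => cycle_adj p.1 x y) P <= G x y /\
    count (fun p => cycle_adj p.2 x y) P = count (fun p => cycle_adj p.1 x y) P.

Definition has_packing (T : eqType) (G : rel T) (k : nat) : Prop :=
  exists2 P, size P = k & packs P G.

Lemma has_packing0 (T : eqType) (G : rel T) : has_packing G 0.
Proof. by exists [::]. Qed.

(** Counts add up, and the pointwise inequality makes [G1] and [G2] edge-disjoint as well as
    contained in [G]. *)
Lemma has_packingD (T : eqType) (G G1 G2 : rel T) k1 k2 :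
    (forall x y, G1 x y + G2 x y <= G x y) ->
  has_packing G1 k1 -> has_packing G2 k2 -> has_packing G (k1 + k2).
Proof.
move=> leG [P1 <- [in1 pk1]] [P2 <- [in2 pk2]]; exists (P1 ++ P2).
  by rewrite size_cat.
split=> [|x y]; first by rewrite all_cat in1.
have [le1 eq1] := pk1 x y; have [le2 eq2] := pk2 x y.
rewrite !count_cat eq1 eq2; split=> //.
by apply: leq_trans (leG x y); apply: leq_add.
Qed.

Lemma has_packingS (T : eqType) (G G1 : rel T) k :
  subrel G1 G -> has_packing G1 k -> has_packing G k.
Proof.
move=> sG [P <- [inP pk]]; exists P; split=> // x y.
have [le1 eq1] := pk x y; split=> //; apply: leq_trans le1 _.
by case: (G1 x y) (sG x y) => // ->.
Qed.

(** * Checking a packing on numbers by computation, and transporting it *)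

Definition packs_below (m : nat) (G : rel nat) (P : seq (seq nat * seq nat)) : bool :=
  [&& all (@inside_pair _) P,
      all (fun p => all (fun x => x < m) p.1) P &
      all (fun x => all (fun y =>
          let k := count (fun p => cycle_adj p.1 x y) P in
          (k <= G x y) && (count (fun p => cycle_adj p.2 x y) P == k))
        (iota 0 m)) (iota 0 m)].

Definition map_pair (S T : eqType) (f : S -> T) (p : seq S * seq S) :=
  (map f p.1, map f p.2).

Lemma cycle_arcs_map (S T : eqType) (f : S -> T) c :
  cycle_arcs (map f c) = [seq (f e.1, f e.2) | e <- cycle_arcs c].
Proof.
rewrite /cycle_arcs -map_rot; elim: c (rot 1 c) => [|x c IH] [|y d] //=.
by rewrite IH.
Qed.

Lemma mem_cycle_arcs (T : eqType) (c : seq T) x y :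
  (x, y) \in cycle_arcs c -> x \in c /\ y \in c.
Proof.
rewrite /cycle_arcs -[in y \in c](mem_rot 1).
elim: c (rot 1 c) => [|a c IH] [|b d] //=; rewrite !inE.
case/orP=> [/eqP[-> ->]|/IH[-> ->]]; first by rewrite !eqxx.
by rewrite !orbT.
Qed.

Section Transport.
Variables (T : eqType) (x0 : T) (s : seq T).
Hypothesis Us : uniq s.
Let f := nth x0 s.

Lemma cycle_arcs_nth c x y : all (fun i => i < size s) c ->
  ((x, y) \in cycle_arcs (map f c)) =
  [&& x \in s, y \in s & (index x s, index y s) \in cycle_arcs c].
Proof.
move=> /allP cs; rewrite cycle_arcs_map; apply/mapP/and3P.
  case=> -[i j] /= ij [-> ->]; have [/cs i_s /cs j_s] := mem_cycle_arcs ij.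
  by rewrite !mem_nth // !index_uniq.
case=> xs ys xy; exists (index x s, index y s) => //=.
by rewrite /f !nth_index.
Qed.

Lemma cycle_adj_nth c x y : all (fun i => i < size s) c ->
  cycle_adj (map f c) x y =
  [&& x \in s, y \in s & cycle_adj c (index x s) (index y s)].
Proof.
move=> cs; rewrite /cycle_adj !cycle_arcs_nth //.
by case: (x \in s); case: (y \in s).
Qed.

(** Renaming [i] to the [i]-th entry of [s] keeps cycles intact because [s] has no repetition;
    [index] is the inverse renaming. *)
Lemma has_packing_nth (G : rel nat) P :
  packs_below (size s) G P ->
  has_packing (fun x y => [&& x \in s, y \in s & G (index x s) (index y s)])
              (size P).
Proof.
case/and3P=> /allP inP /allP ltP /allP cntP; exists (map (map_pair f) P).
  by rewrite size_map.
have ltP2 p : p \in P -> all (fun i => i < size s) p.2.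
  by move=> pP; have /and4P[_ _ /perm_all <- _] := inP p pP; apply: ltP.
split=> [|x y].
  apply/allP=> _ /mapP[p pP ->]; have /and4P[sz Up pp dj] := inP p pP.
  rewrite /inside_pair /= size_map sz perm_map //= cycle_arcs_map all_map.
  rewrite map_inj_in_uniq ?Up /=; last first.
    move=> i j ip jp /eqP; rewrite nth_uniq ?(allP (ltP _ pP)) //.
    by move/eqP.
  apply/allP=> -[i j] ij /=; rewrite cycle_adj_nth ?ltP2 //.
  have [ip jp] := mem_cycle_arcs ij.
  rewrite !mem_nth ?(allP (ltP _ pP)) // !index_uniq ?(allP (ltP _ pP)) //.
  exact: (allP dj _ ij).
rewrite !count_map.
(* A vertex outside [s] lies on no renamed cycle, so both counts vanish there. *)
have [xs|xs] := boolP (x \in s); last first.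
  by split; rewrite !(@eq_in_count _ _ pred0) ?count_pred0 // => p pP /=;
    rewrite cycle_adj_nth ?ltP ?ltP2 // (negPf xs).
have [ys|ys] := boolP (y \in s); last first.
  by split; rewrite !(@eq_in_count _ _ pred0) ?count_pred0 // => p pP /=;
    rewrite cycle_adj_nth ?ltP ?ltP2 // (negPf ys) andbF.
have xi : index x s \in iota 0 (size s) by rewrite mem_iota index_mem.
have yi : index y s \in iota 0 (size s) by rewrite mem_iota index_mem.
have /andP[le1 /eqP eq2] := allP (cntP _ xi) _ yi.
have E1 : {in P, preim (map_pair f) (fun p => cycle_adj p.1 x y) =1
   (fun p => cycle_adj p.1 (index x s) (index y s))}.
  by move=> p pP /=; rewrite cycle_adj_nth ?ltP // xs ys.
have E2 : {in P, preim (map_pair f) (fun p => cycle_adj p.2 x y) =1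
   (fun p => cycle_adj p.2 (index x s) (index y s))}.
  by move=> p pP /=; rewrite cycle_adj_nth ?ltP2 // xs ys.
by rewrite (eq_in_count E1) (eq_in_count E2).
Qed.
End Transport.

(** * Complete and complete bipartite graphs *)

Definition complete (T : eqType) (s : seq T) : rel T :=
  fun x y => [&& x \in s, y \in s & x != y].

Definition bipartite (T : eqType) (A B : seq T) : rel T :=
  fun x y => (x \in A) && (y \in B) || (x \in B) && (y \in A).

Lemma complete_packing (T : eqType) (s : seq T) P :
    uniq s -> packs_below (size s) (fun i j => i != j) P ->
  has_packing (complete s) (size P).
Proof.
case: s => [|x0 s] Us; last first.
  move/(has_packing_nth x0 Us); apply: has_packingS => x y /and3P[xs ys].
  by rewrite /complete xs ys; apply: contra => /eqP->.
(* Without vertices there is no sequence of length 8, so [P] must be empty. *)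
case/and3P=> /allP inP /allP ltP _; case: P inP ltP => [|p P] inP ltP.
  exact: has_packing0.
have /and4P[/eqP sz _ _ _] := inP p (mem_head _ _).
by have := ltP p (mem_head _ _); case: p.1 sz.
Qed.

(** With [A] numbered first, a pair joins the two sides when exactly one of its indices is below
    [size A]. *)
Lemma bipartite_packing (T : eqType) (A B : seq T) P :
    uniq (A ++ B) ->
    packs_below (size A + size B) (fun i j => (i < size A) (+) (j < size A)) P ->
  has_packing (bipartite A B) (size P).
Proof.
rewrite -size_cat => Us; case E : (A ++ B) Us => [|x0 s] Us.
  by move=> pk; apply: (@has_packingS _ _ (complete [::])) => //; apply: complete_packing.
move/(has_packing_nth x0 Us); rewrite -E; apply: has_packingS => x y.
rewrite /bipartite !mem_cat !index_cat => /and3P[xs ys].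
have ltA z : ((if z \in A then index z A else size A + index z B) < size A) = (z \in A).
  by case: ifP => zA; rewrite ?index_mem // ltnNge leq_addr.
by move: xs ys; rewrite !ltA;
  case: (x \in A); case: (x \in B); case: (y \in A); case: (y \in B).
Qed.

(** * Explicit packings of small graphs *)

(** Base cycles developed under the powers of [f]; in the uses below [t] is the order of [f]. *)
Definition develop (f : nat -> nat) t (P : seq (seq nat * seq nat)) :=
  flatten [seq map (map_pair (iter i f)) P | i <- iota 0 t].

(* The permutation (0 1 2)(3 4 5)... of [0, m) with fixed point m - 1. *)
Definition rot3 m x := if x == m.-1 then x else 3 * (x %/ 3) + x.+1 %% 3.

(* The cycles below were found by computer search (simulated annealing), for 13, 17 and 19 vertices among the packings with an automorphism of order 3, 17 and 3. *)
Definition cycles_K44 :=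
  [:: ([:: 0; 4; 1; 5; 2; 6; 3; 7], [:: 0; 5; 3; 4; 2; 7; 1; 6]);
      ([:: 0; 5; 3; 4; 2; 7; 1; 6], [:: 0; 4; 1; 5; 2; 6; 3; 7])].

Definition cycles_K64 :=
  [:: ([:: 7; 0; 6; 3; 9; 1; 8; 4], [:: 4; 6; 1; 7; 3; 8; 0; 9]);
      ([:: 2; 6; 5; 9; 0; 8; 3; 7], [:: 3; 9; 2; 8; 5; 7; 0; 6]);
      ([:: 8; 2; 9; 4; 6; 1; 7; 5], [:: 8; 1; 9; 5; 6; 2; 7; 4])].


(** Three edge-disjoint cycles, each having the next one cyclically as inside cycle; the leave is
    the matching of the pairs {i, i + 4}. *)
Definition cycles_K8 :=
  let c0 := [:: 0; 1; 2; 3; 4; 5; 6; 7] in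
  let c1 := [:: 0; 2; 4; 1; 7; 5; 3; 6] in
  let c2 := [:: 0; 3; 1; 6; 4; 7; 2; 5] in
  [:: (c0, c1); (c1, c2); (c2, c0)].

Definition cycles_K9 :=
  [:: ([:: 3; 6; 7; 4; 0; 2; 8; 5], [:: 8; 3; 7; 2; 5; 4; 6; 0]);
      ([:: 0; 7; 5; 2; 6; 4; 1; 8], [:: 1; 5; 0; 2; 4; 7; 8; 6]);
      ([:: 1; 7; 8; 3; 4; 5; 0; 6], [:: 7; 0; 4; 8; 1; 3; 5; 6]);
      ([:: 2; 7; 3; 1; 5; 6; 8; 4], [:: 6; 3; 4; 1; 7; 5; 8; 2])].

Definition cycles_K10 :=
  [:: ([:: 9; 1; 4; 2; 6; 0; 5; 7], [:: 5; 9; 4; 0; 2; 7; 1; 6]);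
      ([:: 2; 5; 6; 9; 3; 1; 8; 0], [:: 8; 5; 1; 2; 9; 0; 6; 3]);
      ([:: 8; 5; 3; 6; 1; 2; 7; 4], [:: 2; 8; 6; 4; 1; 3; 7; 5]);
      ([:: 0; 4; 9; 5; 1; 7; 8; 3], [:: 8; 4; 3; 5; 0; 7; 9; 1]);
      ([:: 2; 9; 0; 7; 3; 4; 6; 8], [:: 4; 2; 6; 9; 3; 0; 8; 7])].

Definition cycles_K11 :=
  [:: ([:: 8; 6; 10; 5; 2; 9; 7; 4], [:: 6; 9; 4; 10; 2; 8; 5; 7]);
      ([:: 8; 10; 9; 4; 1; 3; 5; 7], [:: 5; 9; 7; 4; 8; 3; 10; 1]);
      ([:: 8; 1; 5; 9; 6; 2; 7; 0], [:: 0; 6; 1; 7; 8; 9; 2; 5]);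
      ([:: 7; 10; 4; 0; 2; 8; 3; 6], [:: 0; 8; 10; 6; 2; 4; 3; 7]);
      ([:: 9; 3; 10; 1; 6; 0; 5; 8], [:: 10; 5; 3; 6; 8; 1; 9; 0]);
      ([:: 7; 1; 9; 0; 10; 2; 4; 3], [:: 10; 7; 2; 0; 4; 1; 3; 9])].

Definition cycles_K13 := develop (rot3 13) 3
  [:: ([:: 4; 10; 12; 7; 3; 1; 8; 6], [:: 7; 10; 3; 6; 12; 1; 4; 8]);
      ([:: 6; 11; 1; 4; 7; 10; 9; 0], [:: 0; 4; 9; 7; 1; 6; 10; 11]);
      ([:: 5; 1; 9; 8; 0; 12; 3; 10], [:: 5; 12; 9; 3; 8; 1; 10; 0])].

Definition cycles_K17 := develop (fun x => x.+1 %% 17) 17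
  [:: ([:: 0; 10; 12; 3; 14; 13; 1; 4], [:: 0; 12; 13; 4; 10; 3; 1; 14])].

Definition cycles_K19 := develop (rot3 19) 3
  [:: ([:: 11; 14; 9; 15; 5; 17; 16; 1], [:: 5; 9; 16; 11; 17; 14; 15; 1]);
      ([:: 14; 3; 1; 18; 17; 10; 8; 7], [:: 1; 17; 7; 3; 18; 10; 14; 8]);
      ([:: 6; 17; 1; 9; 3; 8; 11; 10], [:: 1; 11; 3; 17; 8; 10; 9; 6]);
      ([:: 6; 15; 1; 10; 14; 4; 7; 0], [:: 15; 0; 14; 1; 4; 10; 6; 7]);
      ([:: 16; 6; 18; 14; 1; 5; 4; 13], [:: 18; 1; 13; 5; 14; 6; 4; 16]);
      ([:: 10; 18; 4; 1; 13; 2; 7; 3], [:: 4; 3; 13; 18; 7; 1; 10; 2]);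
      ([:: 3; 11; 16; 14; 6; 12; 13; 17], [:: 6; 3; 16; 17; 12; 14; 11; 13])].

(* These avoid the edges of the complete graph on 6, ..., 10. *)
Definition cycles_K11_hole5 :=
  [:: ([:: 7; 2; 4; 1; 6; 0; 3; 5], [:: 3; 6; 2; 0; 5; 4; 7; 1]);
      ([:: 10; 0; 9; 1; 8; 5; 6; 4], [:: 10; 1; 6; 0; 8; 4; 9; 5]);
      ([:: 3; 8; 0; 7; 4; 5; 2; 10], [:: 0; 10; 4; 2; 8; 5; 7; 3]);
      ([:: 2; 9; 3; 7; 1; 10; 5; 0], [:: 2; 10; 3; 5; 1; 9; 0; 7]);
      ([:: 4; 8; 2; 6; 3; 1; 5; 9], [:: 6; 4; 1; 8; 3; 9; 2; 5])].

Lemma bipartite44 (T : eqType) (A B : seq T) :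
  uniq (A ++ B) -> size A = 4 -> size B = 4 -> has_packing (bipartite A B) 2.
Proof.
by move=> U sA sB; apply: (bipartite_packing (P := cycles_K44) U); rewrite sA sB; vm_compute.
Qed.

Lemma bipartite64 (T : eqType) (A B : seq T) :
  uniq (A ++ B) -> size A = 6 -> size B = 4 -> has_packing (bipartite A B) 3.
Proof.
by move=> U sA sB; apply: (bipartite_packing (P := cycles_K64) U); rewrite sA sB; vm_compute.
Qed.

(** Each listed [k] is the largest possible: the leaves have 4, 4, 5, 7, 6, 0 and 3 edges. *)
Lemma complete_small (T : eqType) (s : seq T) k :
    uniq s ->
    (size s, k) \in [:: (8, 3); (9, 4); (10, 5); (11, 6); (13, 9); (17, 17); (19, 21)] ->
  has_packing (complete s) k.
Proof.
move=> Us; rewrite !inE !xpair_eqE.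
have K P n l : (size s == n) && (k == l) ->
    (size P == l) && packs_below n (fun i j => i != j) P -> has_packing (complete s) k.
  move=> /andP[/eqP sn /eqP->] /andP[/eqP <- pk].
  by apply: complete_packing; rewrite ?sn.
case/orP=> [/K Kn|]; first by apply: (Kn cycles_K8); vm_compute.
case/orP=> [/K Kn|]; first by apply: (Kn cycles_K9); vm_compute.
case/orP=> [/K Kn|]; first by apply: (Kn cycles_K10); vm_compute.
case/orP=> [/K Kn|]; first by apply: (Kn cycles_K11); vm_compute.
case/orP=> [/K Kn|]; first by apply: (Kn cycles_K13); vm_compute.
case/orP=> [/K Kn|]; first by apply: (Kn cycles_K17); vm_compute.
by move/K=> Kn; apply: (Kn cycles_K19); vm_compute.
Qed.

(** * Gluing packings along partitions of the vertices *)

Lemma uniq_cat_mem (T : eqType) (A B : seq T) :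
  uniq (A ++ B) -> forall x, ~~ ((x \in A) && (x \in B)).
Proof.
rewrite cat_uniq => /and3P[_ /hasPn dAB _] x.
by apply/negP => /andP[xA /dAB]; rewrite /= xA.
Qed.

Lemma bipartiteC (T : eqType) (A B : seq T) k :
  has_packing (bipartite A B) k -> has_packing (bipartite B A) k.
Proof. by apply: has_packingS => x y; rewrite /bipartite orbC. Qed.

Lemma bipartite_catl (T : eqType) (A1 A2 B : seq T) k1 k2 :
    uniq ((A1 ++ A2) ++ B) ->
    has_packing (bipartite A1 B) k1 -> has_packing (bipartite A2 B) k2 ->
  has_packing (bipartite (A1 ++ A2) B) (k1 + k2).
Proof.
move=> U; apply: has_packingD => x y.
have d := uniq_cat_mem U; have := d x; have := d y.
have d12 : forall z, ~~ ((z \in A1) && (z \in A2)).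
  by move: U; rewrite cat_uniq => /and3P[/uniq_cat_mem].
have := d12 x; have := d12 y; rewrite /bipartite !mem_cat.
by case: (x \in A1); case: (x \in A2); case: (x \in B);
   case: (y \in A1); case: (y \in A2); case: (y \in B).
Qed.

(** Every [a] other than 1 is a sum of 2s and 3s. Four vertices are peeled off [A] at a time;
    stopping at 3 keeps [a - 2] away from 1. *)
Lemma bipartite_even4 (T : eqType) a (A B : seq T) :
    uniq (A ++ B) -> a != 1 -> size A = 2 * a -> size B = 4 ->
  has_packing (bipartite A B) a.
Proof.
elim/ltn_ind: a A => a IH A U a1 sA sB.
have [a0|a_gt0] := posnP a.
  by rewrite a0; apply: has_packing0.
have [a2|a2] := eqVneq a 2; first by rewrite a2; apply: bipartite44; rewrite ?sA ?a2.
have [a3|a3] := eqVneq a 3; first by rewrite a3; apply: bipartite64; rewrite ?sA ?a3.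
have sT : size (take 4 A) = 4 by rewrite size_takel; lia.
have sD : size (drop 4 A) = 2 * (a - 2) by rewrite size_drop; lia.
have -> : a = 2 + (a - 2) by lia.
have := U; rewrite -{1}(cat_take_drop 4 A) => U2.
rewrite -{1}(cat_take_drop 4 A); apply: bipartite_catl => //.
  apply: bipartite44 => //; move: U2; rewrite -catA uniq_catCA cat_uniq.
  by case/and3P.
apply: IH => //; try lia.
by move: U2; rewrite -catA cat_uniq => /and3P[].
Qed.

Lemma bipartite_even (T : eqType) a b (A B : seq T) :
    uniq (A ++ B) -> a != 1 -> size A = 2 * a -> size B = 4 * b ->
  has_packing (bipartite A B) (a * b).
Proof.
move=> U a1 sA; elim: b B U => [|b IH] B U sB.
  by rewrite muln0; apply: has_packing0.
have sT : size (take 4 B) = 4 by rewrite size_takel; lia.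
have sD : size (drop 4 B) = 4 * b by rewrite size_drop; lia.
rewrite mulnS; apply: bipartiteC.
have := U; rewrite -{1}(cat_take_drop 4 B) => U2.
rewrite -{1}(cat_take_drop 4 B); apply: bipartite_catl.
- by rewrite uniq_catC.
- apply/bipartiteC/bipartite_even4 => //.
  by move: U2; rewrite catA cat_uniq => /and3P[].
- apply/bipartiteC/IH => //.
  by move: U2; rewrite uniq_catCA cat_uniq => /and3P[].
Qed.

Lemma complete_cat (T : eqType) (A B : seq T) k1 k2 k3 :
    uniq (A ++ B) -> has_packing (complete A) k1 -> has_packing (complete B) k2 ->
    has_packing (bipartite A B) k3 ->
  has_packing (complete (A ++ B)) (k1 + k2 + k3).
Proof.
move=> U pA pB; have d := uniq_cat_mem U; apply: has_packingD; last first.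
  apply: (@has_packingD _ (fun x y => complete A x y || complete B x y)) pA pB => x y.
  have := d x; rewrite /complete.
  by case: (x \in A); case: (x \in B); case: (y \in A); case: (y \in B); case: eqVneq.
move=> x y; have := d x; have := d y; rewrite /complete /bipartite !mem_cat.
case: eqVneq => [->|_]; first by case: (y \in A); case: (y \in B).
by case: (x \in A); case: (x \in B); case: (y \in A); case: (y \in B).
Qed.

(** The two cliques meet only in [z], so they share no edge. An odd total thus splits into two even
    sets [A] and [B]. *)
Lemma complete_cat_point (T : eqType) z (A B : seq T) k1 k2 k3 :
    uniq (z :: A ++ B) ->
    has_packing (complete (z :: A)) k1 -> has_packing (complete (z :: B)) k2 ->
    has_packing (bipartite A B) k3 ->
  has_packing (complete (z :: A ++ B)) (k1 + k2 + k3).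
Proof.
move=> /= /andP[zAB /uniq_cat_mem d] pA pB; move: zAB; rewrite mem_cat negb_or => /andP[zA zB].
apply: has_packingD; last first.
  apply: (@has_packingD _ (fun x y => complete (z :: A) x y || complete (z :: B) x y)) pA pB => x y.
  have := d x; have := d y; rewrite /complete !inE.
  case: (eqVneq x y) => [_|xy]; rewrite ?andbF //.
  case: (eqVneq x z) xy => [->|_] xy; case: (eqVneq y z) xy => [->|_]; rewrite ?eqxx ?(negPf zA) ?(negPf zB) //= => _;
  by case: (x \in A); case: (x \in B); case: (y \in A); case: (y \in B).
move=> x y; have := d x; have := d y; rewrite /complete /bipartite !inE !mem_cat.
case: (eqVneq x y) => [->|_]; first by case: (y \in A); case: (y \in B); rewrite ?andbF.
case: (eqVneq x z) => [->|_]; case: (eqVneq y z) => [->|_]; rewrite ?(negPf zA) ?(negPf zB) //=;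
by case: (x \in A); case: (x \in B); case: (y \in A); case: (y \in B).
Qed.

(** Numbering [C] first makes the hole of [cycles_K11_hole5] fall on [D]. *)
Lemma complete_minus_K5 (T : eqType) (C D : seq T) :
    uniq (C ++ D) -> size C = 6 -> size D = 5 ->
  has_packing (fun x y => complete C x y || bipartite C D x y) 5.
Proof.
move=> U sC sD; case: C U sC => [//|x0 C'] U; set C := x0 :: C' in U *; move=> sC.
have pk : packs_below (size (C ++ D))
    (fun i j => [&& i != j & ((i < 6) || (j < 6))]) cycles_K11_hole5.
  by rewrite size_cat sC sD; vm_compute.
apply: has_packingS (has_packing_nth x0 U pk) => x y.
have d := uniq_cat_mem U; have := d x; have := d y.
rewrite /complete /bipartite !mem_cat !index_cat -sC.
have ltC z : ((if z \in C then index z C else size C + index z D) < size C) = (z \in C).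
  by case: ifP => zC; rewrite ?index_mem // ltnNge leq_addr.
rewrite !ltC; case: (eqVneq x y) => [->|_]; rewrite ?eqxx ?andbF //=.
by case: (x \in C); case: (x \in D); case: (y \in C); case: (y \in D); rewrite ?andbF.
Qed.

(** The edges meeting [C] split in two: those inside [C] or to [z :: D] form [K_11] minus [K_5], and
    those to [B] form [K_{6,4b}]. The hole on [z :: D] belongs to the remaining complete graph. *)
Lemma complete_cat_six (T : eqType) z (C D B : seq T) b k :
    uniq (C ++ z :: D ++ B) -> size C = 6 -> size D = 4 -> size B = 4 * b ->
    has_packing (complete (z :: D ++ B)) k ->
  has_packing (complete (C ++ z :: D ++ B)) (k + 5 + 3 * b).
Proof.
move=> U sC sD sB pk.
have UB : uniq (C ++ B) by move: U; rewrite -cat_cons uniq_catCA cat_uniq => /and3P[].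
have UD : uniq (C ++ z :: D) by move: U; rewrite -cat_cons catA cat_uniq => /and3P[].
have pB := bipartite_even UB (isT : 3 != 1) sC sB.
have pD : has_packing (fun x y => complete C x y || bipartite C (z :: D) x y) 5.
  by apply: complete_minus_K5; rewrite //= sD.
have dz : forall x, ~~ ((x \in z :: D) && (x \in B)).
  by move: U; rewrite cat_uniq -cat_cons => /and3P[_ _ /uniq_cat_mem].
have dB := uniq_cat_mem UB; have dD := uniq_cat_mem UD.
apply: has_packingD pB => [|]; last first.
  apply: (@has_packingD _ (fun x y => [|| complete (z :: D ++ B) x y, complete C x y |
      bipartite C (z :: D) x y])) pk pD => x y.
  have := dz x; have := dB x; have := dD x; have := dz y; have := dB y; have := dD y.
  rewrite /complete /bipartite -cat_cons !mem_cat.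
  by case: (x \in C); case: (x \in z :: D); case: (x \in B); case: (y \in C);
    case: (y \in z :: D); case: (y \in B); rewrite ?andbF // => *; case: eqVneq.
move=> x y; have := dz x; have := dB x; have := dD x; have := dz y; have := dB y; have := dD y.
rewrite /complete /bipartite -cat_cons !mem_cat.
case: eqVneq => [->|_]; first by case: (y \in C); case: (y \in z :: D); case: (y \in B).
by case: (x \in C); case: (x \in z :: D); case: (x \in B); case: (y \in C);
    case: (y \in z :: D); case: (y \in B).
Qed.

(** * Induction on the number of vertices, by parity *)

(* By the final bound, fewer than [n / 2 + 8] edges remain uncovered. *)
Lemma even_packing n (T : eqType) (s : seq T) :
    uniq s -> size s = n -> ~~ odd n -> n != 2 -> n != 6 ->
  exists2 k, has_packing (complete s) k & n * n.-1 < 16 * k + n + 16.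
Proof.
elim/ltn_ind: n s => n IH s Us sn n_even n2 n6.
have [n4|n_gt4] := leqP n 4.
  by exists 0; [apply: has_packing0 | case: n n4 n2 {IH sn n_even n6} => [|[|[|[|[|n]]]]]].
(* Removing 8 vertices from 10 or 14 would leave 2 or 6, both excluded; 14 is split as 10 + 4
   below. *)
have [n10|n10] := eqVneq n 10.
  by exists 5; [apply: complete_small; rewrite // sn n10 | rewrite n10].
have step r : r \in [:: 4; 8] -> r <= n -> n - r != 2 ->
    forall k1 k2, has_packing (complete (take (n - r) s)) k1 ->
    (forall B : seq T, uniq B -> size B = r -> has_packing (complete B) k2) ->
  has_packing (complete s) (k1 + k2 + (n - r)./2 * (r %/ 4)).
  move=> r48 rn nr2 k1 k2 pA pB; have Us2 := Us.
  rewrite -(cat_take_drop (n - r) s) in Us2 *.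
  have sA : size (take (n - r) s) = 2 * (n - r)./2.
    by rewrite size_takel; move: r48; rewrite !inE => /orP[]/eqP re; lia.
  have sB : size (drop (n - r) s) = r by rewrite size_drop; lia.
  apply: complete_cat => //.
    by apply: pB => //; move: Us2; rewrite cat_uniq => /and3P[].
  by apply: bipartite_even => //; move: r48; rewrite !inE => /orP[]/eqP re; subst r; lia.
have [n14|n14] := eqVneq n 14.
  exists 10; last by rewrite n14.
  have := @step 4; rewrite n14 => /(_ isT isT isT 5 0); apply=> [|B _ _].
    by apply: complete_small; rewrite ?take_uniq // size_takel // sn n14.
  exact: has_packing0.
have [||||||k pk lek] := IH (n - 8) _ (take (n - 8) s); try by rewrite ?take_uniq //; lia.
  by rewrite size_takel; lia.
(* [K_8] leaves 4 edges and the bipartite part none, while n / 2 grows by 4, so the slack in the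
   bound is unchanged. *)
exists (k + 3 + (n - 8)./2 * 2); last first.
  have [j nE] : exists j, n = j.*2 + 8 by exists (n - 8)./2; lia.
  (* The case [j = 0] is separated because the predecessor truncates there. *)
  by move: lek; rewrite nE addnK doubleK; case: j {nE} => [|j]; lia.
apply: (@step 8 _ _ _ k 3) => //; try lia.
by move=> B UB sB; apply: complete_small; rewrite // sB.
Qed.

(* By the final bounds, at most 10 and not exactly 8 edges remain uncovered. *)
Lemma odd_packing n (T : eqType) (s : seq T) :
    uniq s -> size s = n -> odd n -> n != 3 -> n != 7 ->
  exists2 k, has_packing (complete s) k &
    n * n.-1 <= 16 * k + 20 /\ n * n.-1 != 16 * k + 16.
Proof.
elim/ltn_ind: n s => n IH s Us sn n_odd n3 n7.
have small k : (n, k) \in [:: (9, 4); (11, 6); (13, 9); (19, 21)] ->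
   exists2 k, has_packing (complete s) k &
     n * n.-1 <= 16 * k + 20 /\ n * n.-1 != 16 * k + 16.
  move=> nk; exists k.
    apply: complete_small => //; rewrite sn; move: nk; rewrite !inE.
    by do 3?case/orP; move=> ->; rewrite ?orbT.
  move: nk; rewrite !inE !xpair_eqE.
  by do 3?case/orP; case/andP=> /eqP-> /eqP->.
have six b k : n = 11 + 4 * b ->
    (forall B : seq T, uniq B -> size B = 5 + 4 * b -> has_packing (complete B) k) ->
  has_packing (complete s) (k + 5 + 3 * b).
  move=> nb pB; have Us2 := Us.
  rewrite -(cat_take_drop 6 s) in Us2 *.
  have: size (drop 6 s) = 5 + 4 * b by rewrite size_drop; lia.
  have: size (take 6 s) = 6 by rewrite size_takel; lia.
  case: (drop 6 s) Us2 => [//|z t] Us2 s6 st; move: Us2 st.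
  rewrite -(cat_take_drop 4 t) => Us2 st.
  have s4 : size (take 4 t) = 4.
    by rewrite size_takel //; move: st; rewrite /= cat_take_drop; lia.
  apply: complete_cat_six => //; first by move: st; rewrite /= size_cat s4; lia.
  by apply: pB => //; move: Us2; rewrite cat_uniq => /and3P[].
have [n5|n_gt5] := leqP n 5.
  exists 0; first exact: has_packing0.
  by case: n n5 n3 n_odd {IH sn n7 small six} => [|[|[|[|[|[|n]]]]]].
have [n9|n9] := eqVneq n 9; first by apply: (small 4); rewrite n9.
have [n11|n11] := eqVneq n 11; first by apply: (small 6); rewrite n11.
have [n13|n13] := eqVneq n 13; first by apply: (small 9); rewrite n13.
(* Removing 16 vertices from 19 or 23 would leave 3 or 7, both excluded, so these are handled
   directly. *)
have [n19|n19] := eqVneq n 19; first by apply: (small 21); rewrite n19.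
have [n15|n15] := eqVneq n 15.
  (* Here 15 = 6 + 9 gives 4 + 5 + 3 cycles; below, 23 = 6 + 17 gives 17 + 5 + 9. *)
  exists 12; last by rewrite n15.
  by apply: (six 1 4) => // B UB sB; apply: complete_small; rewrite // sB.
have [n23|n23] := eqVneq n 23.
  exists 31; last by rewrite n23.
  by apply: (six 3 17) => // B UB sB; apply: complete_small; rewrite // sB.
have {small six} n17 : 16 < n by lia.
case: s Us sn => [|z t] Us sn; first by move: sn => /=; lia.
move: sn Us; rewrite -(cat_take_drop (n - 17) t) => sn Us.
have sA : size (take (n - 17) t) = n - 17 by rewrite size_takel //; move: sn; rewrite /= cat_take_drop; lia.
have sB : size (drop (n - 17) t) = 16 by move: sn; rewrite /= size_cat sA; lia.
have [zA zB] : z \notin take (n - 17) t /\ z \notin drop (n - 17) t.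
  by move: Us => /= /andP[]; rewrite mem_cat => /norP[].
have [UA dAB UB] : [/\ uniq (take (n - 17) t), uniq (take (n - 17) t ++ drop (n - 17) t)
     & uniq (drop (n - 17) t)].
  by move: Us => /= /andP[_ U]; split=> //; move: U; rewrite cat_uniq => /and3P[].
have [||||||k pk [lek nek]] := IH (n - 16) _ (z :: take (n - 17) t); rewrite ?size_takel //=; try by rewrite ?zA ?UA ?sA; lia.
(* [K_17] and the bipartite part are decomposed completely, so the number of uncovered edges is that
   of the smaller packing. *)
exists (k + 17 + (n - 17)./2 * 4); last first.
  have [j nE] : exists j, n = j.*2 + 17 by exists (n - 17)./2; lia.
  rewrite nE addnK doubleK; move: lek nek; rewrite nE.
  by rewrite (_ : j.*2 + 17 - 16 = j.*2.+1) /=; lia.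
apply: complete_cat_point => //.
  by apply: complete_small; rewrite /= ?zB // sB.
by apply: bipartite_even; rewrite ?sA ?sB //; lia.
Qed.

(** * Edges and degrees of an 8-cycle *)

Section CycleEdges.
Variables (n : nat) (c : cyc8 n).
Hypothesis Uc : is_cyc8 c.

Lemma tnth_inj : injective (tnth c).
Proof. exact/tuple_uniqP. Qed.

Let cedge (i : 'I_8) := [set tnth c i; tnth c (ordS i)].

Lemma ordS_neq (i : 'I_8) : (ordS i == i) = false.
Proof. by case: i => [[|[|[|[|[|[|[|[|i]]]]]]]] lti]. Qed.

Lemma tnth_ordS_neq i : tnth c i != tnth c (ordS i).
Proof. by rewrite (inj_eq tnth_inj) eq_sym ordS_neq. Qed.

(** Two indices giving the same edge in opposite directions would make [ordS] applied twice fix an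
    index, impossible modulo 8. *)
Lemma cedge_inj : injective cedge.
Proof.
move=> i j eij.
have: tnth c i \in cedge j by rewrite -eij !inE eqxx.
have: tnth c (ordS i) \in cedge j by rewrite -eij !inE eqxx orbT.
rewrite !inE !(inj_eq tnth_inj) => Sij /orP[/eqP->//|/eqP eSj].
move: Sij; rewrite {}eSj ordS_neq orbF.
by case: j {eij} => [[|[|[|[|[|[|[|[|j]]]]]]]] ltj].
Qed.

Lemma card_cedges : #|cedges c| = 8.
Proof. by rewrite card_imset ?card_ord //; apply: cedge_inj. Qed.

Lemma cedges_is_edge e : e \in cedges c -> is_edge e.
Proof. by case/imsetP=> i _ ->; rewrite /is_edge cards2 tnth_ordS_neq. Qed.

(** The edges at [v] come from the indices where [v] is the first end and those where it is the
    second. These sets are disjoint, and [ordS] matches them up. *)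
Lemma cedges_deg_even v : ~~ odd #|[set e in cedges c | v \in e]|.
Proof.
have -> : [set e in cedges c | v \in e] =
    cedge @: ([set i | tnth c i == v] :|: [set i | tnth c (ordS i) == v]).
  apply/setP=> e; rewrite inE; apply/andP/imsetP.
    case=> /imsetP[i _ ->]; rewrite !inE => vi; exists i => //.
    by rewrite !inE ![_ == v]eq_sym.
  case=> i; rewrite !inE => vi ->; split; first exact: imset_f.
  by rewrite !inE ![v == _]eq_sym.
rewrite card_imset; last exact: cedge_inj.
rewrite cardsU (_ : _ :&: _ = set0) ?cards0 ?subn0; last first.
  apply/setP=> i; rewrite !inE; apply/negP=> /andP[/eqP <-].
  by rewrite eq_sym (negPf (tnth_ordS_neq i)).
have -> : [set i | tnth c (ordS i) == v] = (@ordS 8) @^-1: [set i | tnth c i == v].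
  by apply/setP=> i; rewrite !inE.
by rewrite card_preimset ?addnn ?odd_double //; apply: ordS_inj.
Qed.

End CycleEdges.

(** * Size and degrees of the leave, and the lower bounds they force *)

Lemma leave_cons n (c : cyc8 n) C : leave (c :: C) = leave C :\: cedges c.
Proof.
apply/setP=> e; rewrite !inE /=.
by case: (is_edge e); case: (e \in cedges c); rewrite ?andbT ?andbF.
Qed.

Lemma cedges_sub_leave n (c : cyc8 n) C :
  is_packing (c :: C) -> cedges c \subset leave C.
Proof.
case/andP=> /= /andP[Uc _] /andP[/allP dC _].
apply/subsetP=> e ec; rewrite inE (cedges_is_edge Uc ec) /=.
by apply/allP=> d /dC /pred0P /(_ e) /=; rewrite ec /= => ->.
Qed.

Lemma is_packing_behead n (c : cyc8 n) C :
  is_packing (c :: C) -> is_cyc8 c /\ is_packing C.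
Proof. by case/andP=> /= /andP[Uc UC] /andP[_ pC]; split=> //; apply/andP. Qed.

Lemma card_leave n (C : seq (cyc8 n)) :
  is_packing C -> #|leave C| + 8 * size C = 'C(n, 2).
Proof.
elim: C => [|c C IH] pC.
  rewrite addn0 -[in RHS](card_ord n) -card_draws.
  by apply: eq_card => e; rewrite !inE andbT.
have [Uc {}/IH IH] := is_packing_behead pC.
have := cardsID (cedges c) (leave C).
rewrite (setIidPr (cedges_sub_leave pC)) card_cedges // -leave_cons.
by rewrite -IH /=; lia.
Qed.

Definition leave_deg n (C : seq (cyc8 n)) (v : 'I_n) := #|[set e in leave C | v \in e]|.

(** The empty packing leaves [K_n], whose edges at [v] correspond to the other vertices; each
    further cycle removes an even number of them. *)
Lemma odd_leave_deg n (C : seq (cyc8 n)) v :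
  is_packing C -> odd (leave_deg C v) = odd n.-1.
Proof.
elim: C => [|c C IH] pC.
  have -> : n.-1 = #|[set~ v]| by rewrite cardsC1 card_ord.
  rewrite -(@card_in_imset _ _ (fun x => [set v; x])); last first.
    move=> x y; rewrite !inE => xv yv exy.
    have: x \in [set v; y] by rewrite -exy !inE eqxx orbT.
    by rewrite !inE (negPf xv) => /eqP.
  congr odd; apply: eq_card => e; rewrite !inE andbT.
  apply/andP/imsetP.
    case=> /cards2P[x [y [xy ->]]]; rewrite !inE => /orP[]/eqP ->.
      by exists y; rewrite // !inE eq_sym.
    by exists x; rewrite ?inE // setUC.
  by case=> x; rewrite !inE => xv ->; rewrite /is_edge cards2 (eq_sym v) xv !inE eqxx.
have [Uc /IH <-] := is_packing_behead pC.
have := cardsID (cedges c) [set e in leave C | v \in e].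
rewrite /leave_deg.
have -> : [set e in leave C | v \in e] :&: cedges c = [set e in cedges c | v \in e].
  apply/setP=> e; have := subsetP (cedges_sub_leave pC) e; rewrite !inE.
  by case: (e \in cedges c) => [->|]; rewrite ?andbT ?andbF.
have -> : [set e in leave C | v \in e] :\: cedges c = [set e in leave (c :: C) | v \in e].
  by apply/setP=> e; rewrite leave_cons !inE andbA.
by move=> <-; rewrite oddD (negPf (cedges_deg_even Uc v)).
Qed.

(** All degrees are odd, hence positive: the leave covers every vertex, and an edge covers only
    two. *)
Lemma leave_even_ge n (C : seq (cyc8 n)) :
  is_packing C -> 0 < n -> ~~ odd n -> n <= 2 * #|leave C|.
Proof.
move=> pC n_gt0 n_even.
have -> : 2 * #|leave C| = \sum_(e in leave C) #|e|.
  rewrite mulnC -sum_nat_const; apply: eq_bigr => e.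
  by rewrite inE => /andP[/eqP-> _].
apply: leq_trans (leq_card_cover _); rewrite -{1}(card_ord n).
apply/subset_leq_card/subsetP=> v _.
have: odd (leave_deg C v) by rewrite odd_leave_deg //; lia.
rewrite /leave_deg; case: (set_0Vmem [set e in leave C | v \in e]) => [->|[e]].
  by rewrite cards0.
by rewrite inE => /andP[eL ve] _; apply/bigcupP; exists e.
Qed.

(** With one edge, or two distinct ones, some vertex would lie on exactly one edge of the leave,
    although all degrees are even. *)
Lemma leave_odd_neq n (C : seq (cyc8 n)) :
  is_packing C -> odd n -> (#|leave C| != 1) && (#|leave C| != 2).
Proof.
move=> pC n_odd.
have deg_even v : ~~ odd (leave_deg C v) by rewrite odd_leave_deg //; lia.
have no_private e v : e \in leave C -> v \in e ->
    (forall f, f \in leave C -> v \in f -> f = e) -> False.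
  move=> eL ve priv; have := deg_even v.
  rewrite /leave_deg (_ : [set f in leave C | v \in f] = [set e]) ?cards1 //.
  apply/setP=> f; rewrite in_set1 in_set.
  by apply/andP/eqP=> [[fL vf]|->]; first exact: priv.
have card_edge e : e \in leave C -> #|e| = 2 by rewrite inE => /andP[/eqP].
apply/andP; split; apply/negP.
  case/cards1P=> e Le; have eL : e \in leave C by rewrite Le inE.
  have /card_gt0P[v ve] : 0 < #|e| by rewrite card_edge.
  by apply: (no_private e v) => // f; rewrite Le inE => /eqP.
case/cards2P=> e [f [ef Le]].
have eL : e \in leave C by rewrite Le !inE eqxx.
have fL : f \in leave C by rewrite Le !inE eqxx orbT.
have /subsetPn[v ve vf] : ~~ (e \subset f).
  by apply: contra ef => sef; rewrite eqEcard sef !card_edge.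
apply: (no_private e v) => // g; rewrite Le !inE => /orP[/eqP//|/eqP->].
by rewrite (negPf vf).
Qed.

(** * From packings by sequences to packings by tuples *)

Lemma cycle_arcs_tnth n (c : cyc8 n) x y :
  ((x, y) \in cycle_arcs c) = [exists i, (tnth c i == x) && (tnth c (ordS i) == y)].
Proof.
have szz : size (cycle_arcs c) = 8 by rewrite size_zip size_rot size_tuple.
have nthE (i : 'I_8) : nth (x, y) (cycle_arcs c) i = (tnth c i, tnth c (ordS i)).
  rewrite nth_zip ?size_rot // !(tnth_nth x); congr pair.
  case: c {szz} => -[|a0[|a1[|a2[|a3[|a4[|a5[|a6[|a7[|a8 s]]]]]]]]] //= _.
  by case: i => [[|[|[|[|[|[|[|[|i]]]]]]]] lti].
apply/(nthP (x, y))/existsP.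
  case=> i; rewrite szz => lti; rewrite -[i]/(nat_of_ord (Ordinal lti)) nthE => -[<- <-].
  by exists (Ordinal lti); rewrite !eqxx.
by case=> i /andP[/eqP ex /eqP ey]; exists i; rewrite ?szz // nthE ex ey.
Qed.

Lemma cedges_adj n (c : cyc8 n) x y :
  ([set x; y] \in cedges c) = cycle_adj c x y.
Proof.
rewrite /cycle_adj !cycle_arcs_tnth; apply/imsetP/orP; last first.
  by case=> /existsP[i /andP[/eqP<- /eqP<-]]; exists i; rewrite // setUC.
case=> i _ exy.
have: tnth c i \in [set x; y] by rewrite exy !inE eqxx.
have: tnth c (ordS i) \in [set x; y] by rewrite exy !inE eqxx orbT.
have: x \in [set tnth c i; tnth c (ordS i)] by rewrite -exy !inE eqxx.
have: y \in [set tnth c i; tnth c (ordS i)] by rewrite -exy !inE eqxx orbT.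
rewrite !inE => yi xi Si_xy i_xy.
have [xi'|xi'] := eqVneq (tnth c i) x.
  left; apply/existsP; exists i; rewrite xi' eqxx /=.
  by case/orP: yi Si_xy => /eqP yE; rewrite -?yE ?eqxx // yE xi' orbb.
right; apply/existsP; exists i; move: i_xy; rewrite (negPf xi') => /= /eqP ->.
by rewrite eqxx; move: xi; rewrite eq_sym (negPf xi') => /= /eqP->; rewrite eqxx.
Qed.

Lemma edgeP n (e : edge n) : is_edge e -> exists x y, e = [set x; y].
Proof. by case/cards2P=> x [y [_ ->]]; exists x, y. Qed.

Lemma leaveE n (C : seq (cyc8 n)) x y :
  ([set x; y] \in leave C) = (x != y) && (count (fun c : cyc8 n => cycle_adj c x y) C == 0).
Proof.
rewrite inE /is_edge cards2; case: (x != y) => //=; rewrite -leqn0 leqNgt -has_count.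
by rewrite -all_predC; apply: eq_all => c /=; rewrite cedges_adj.
Qed.

Lemma cverts_mem n (c : cyc8 n) : cverts c = [set x in c].
Proof.
apply/setP=> x; rewrite inE; apply/imsetP/tnthP.
  by case=> i _ ->; exists i.
by case=> i ->; exists i.
Qed.

(** An edge shared by two cycles of the list would be counted at least twice. *)
Lemma is_packing_count n (C : seq (cyc8 n)) :
    all (@is_cyc8 n) C ->
    (forall x y, count (fun c : cyc8 n => cycle_adj c x y) C <= 1) ->
  is_packing C.
Proof.
rewrite /is_packing => -> /=; elim: C => [|c C IH] //= cnt.
apply/andP; split; last by apply: IH => x y; apply: leq_trans (cnt x y); apply: leq_addl.
apply/allP=> d dC; apply/pred0P=> e /=; apply/negP=> /andP[/imsetP[i _ ->]].
set x := tnth c i; set y := tnth c (ordS i) => exd.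
have := cnt x y; rewrite -!cedges_adj (imset_f (fun i => [set tnth c i; tnth c (ordS i)])) //.
rewrite add1n ltnNge -has_count => /negP; apply; apply/hasP; exists d => //.
by rewrite -cedges_adj.
Qed.

Lemma packing_A2P n k : 0 < n -> has_packing (complete (enum 'I_n)) k ->
  exists C : seq (cyc8 n), [/\ is_packing C, A2P C & size C = k].
Proof.
move=> n_gt0 [P sP [/allP inP cntP]].
(* The default tuple is never reached, since all sequences in [P] have length 8. *)
pose tup (c : seq 'I_n) : cyc8 n := insubd [tuple of nseq 8 (Ordinal n_gt0)] c.
have val1 p : p \in P -> tup p.1 = p.1 :> seq _.
  by move/inP => /and4P[sz _ _ _]; rewrite val_insubd sz.
have val2 p : p \in P -> tup p.2 = p.2 :> seq _.
  by move/inP => /and4P[sz _ /perm_size eqs _]; rewrite val_insubd -eqs sz.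
pose C := [seq tup p.1 | p <- P]; pose D := [seq tup p.2 | p <- P].
have cntC x y : count (fun c : cyc8 n => cycle_adj c x y) C =
                count (fun p => cycle_adj p.1 x y) P.
  by rewrite count_map; apply: eq_in_count => p pP /=; rewrite val1.
have cntD x y : count (fun c : cyc8 n => cycle_adj c x y) D =
                count (fun p => cycle_adj p.1 x y) P.
  by rewrite count_map -(cntP x y).2; apply: eq_in_count => p pP /=; rewrite val2.
have cnt1 x y : count (fun p => cycle_adj p.1 x y) P <= 1.
  by apply: leq_trans (cntP x y).1 _; case: complete.
have UC : all (@is_cyc8 n) C.
  by apply/allP=> _ /mapP[p pP ->]; rewrite /is_cyc8 val1 //; case/and4P: (inP p pP).
have UD : all (@is_cyc8 n) D.
  apply/allP=> _ /mapP[p pP ->]; rewrite /is_cyc8 val2 //.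
  by case/and4P: (inP p pP) => _ U /perm_uniq <-.
exists C; split; last by rewrite size_map.
  by apply: is_packing_count => // x y; rewrite cntC.
exists D; split; last split.
- rewrite /C /D all2E !size_map eqxx zip_map all_map; apply/allP=> p pP /=.
  have /and4P[_ U pp /allP dj] := inP p pP.
  rewrite /inside; apply/and3P; split.
  + exact: (allP UD _ (map_f (fun p => tup p.2) pP)).
  + apply/eqP/setP=> x; rewrite !cverts_mem !inE !memtE val1 // val2 //.
    by rewrite (perm_mem pp).
  + apply/pred0P=> e /=; apply/negP=> /andP[/imsetP[i _ ->]].
    rewrite cedges_adj val2 //; apply/negP.
    have arc : (tnth (tup p.1) i, tnth (tup p.1) (ordS i)) \in cycle_arcs (tup p.1).
      by rewrite cycle_arcs_tnth; apply/existsP; exists i; rewrite !eqxx.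
    by rewrite val1 // in arc; apply: (dj _ arc).
- by apply: is_packing_count => // x y; rewrite cntD.
(* The adjacency counts determine the leave, and they agree for [C] and [D]. *)
- apply/setP=> e; have [/edgeP[x [y ->]]|ne] := boolP (is_edge e).
    by rewrite !leaveE cntC cntD.
  by rewrite !inE (negPf ne).
Qed.

(** * Maximality, by comparing sizes of leaves modulo 8 *)

Unset Implicit Arguments.

Theorem mainTheorem1 (n : nat) : 8 <= n ->
  exists C : seq (cyc8 n), is_max_packing C /\ A2P C.
Proof.
move=> n8; have n_gt0 : 0 < n by apply: leq_trans n8.
have Us := enum_uniq 'I_n; have sn : size (enum 'I_n) = n by rewrite size_enum_ord.
(* Doubling clears the division in the binomial and matches the form of the packing bounds. *)
have bin C : is_packing C -> 2 * #|@leave n C| + 16 * size C = n * n.-1.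
  have ev : ~~ odd (n * n.-1) by rewrite oddM; lia.
  by move/card_leave; rewrite bin2; lia.
have [n_odd|n_even] := boolP (odd n).
  have [||k pk [lek nek]] := odd_packing Us sn n_odd; try lia.
  have [C [pC aC sC]] := packing_A2P n_gt0 pk.
  exists C; split=> //; split=> // C' pC'.
  have /andP[ne1 ne2] := leave_odd_neq pC' n_odd.
  (* Leaves differ in size by multiples of 8, so a smaller one would have at most 2 edges: 0 would
     mean that [C] leaves 8, and 1 and 2 are ruled out. *)
  have := bin C pC; have := bin C' pC'; rewrite sC; lia.
have [||k pk lek] := even_packing Us sn n_even; try lia.
have [C [pC aC sC]] := packing_A2P n_gt0 pk.
exists C; split=> //; split=> // C' pC'.
have := leave_even_ge pC' n_gt0 n_even.
(* A smaller leave would have at least 8 edges fewer, hence fewer than n / 2. *)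
have := bin C pC; have := bin C' pC'; rewrite sC; lia.
Qed.
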